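(* Fix a prime $p$. The space of all lineons (over $\mathbb F_p$), viewed as a subset of $[0,1]^{\mathcal F}$ with the product topology, is path-connected.
   Context: Let $\mathcal F$ be the countable set of all pairs $(m,f)$ with $m\ge1$ and $f:\mathbb F_p^m\setminus\{0^m\}\to\{0,1\}$. For $A\subseteq\mathbb F_p^n$ with $n\ge m$, let $p(f,A)$ be the probability that, for a uniformly random linear map $\bm\alpha:\mathbb F_p^m\to\mathbb F_p^n$, $(\mathbf 1_A\circ\bm\alpha)|_{\mathbb F_p^m\setminus\{0^m\}}=f$, where $\mathbf 1_A$ is the characteristic function of $A$; let $p(-,A)\in[0,1]^{\mathcal F}$ be the vector of these densities (with arbitrary values, say $0$, for $m>n$). A lineon is a point $\psi\in[0,1]^{\mathcal F}$ such that there exist $n_1<n_2<\cdots$ and sets $A_{n_t}\subseteq\mathbb F_p^{n_t}$ with $\lim_{t\to\infty}p((m,f),A_{n_t})=\psi((m,f))$ for every $(m,f)\in\mathcal F$. *)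

(* Defs.v *)
From HB Require Import structures.
From mathcomp Require Import all_boot all_order all_algebra.
From mathcomp Require Import all_classical all_reals all_analysis.

Set Implicit Arguments.
Unset Strict Implicit.
Unset Printing Implicit Defensive.

Import Order.TTheory GRing.Theory Num.Theory.
Import numFieldNormedType.Exports.

Local Open Scope classical_set_scope.
Local Open Scope ring_scope.

Definition path_connected (R : realType) (T : topologicalType) (X : set T) :=
  forall x y : T, X x -> X y ->
  exists gamma : R -> T,
    [/\ {within `[0, 1], continuous gamma},
        gamma 0 = x,
        gamma 1 = y &
        forall t : R, t \in `[0, 1] -> X (gamma t)].

Definition nzvec (p m : nat) := {v : 'rV['F_p]_m | v != 0}.

Definition pattern (p : nat) :=
  {mf : {m : nat & {ffun nzvec p m -> bool}} | (0 < tag mf)%N}.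

Definition pattern_dim p (F : pattern p) : nat := tag (val F).

Definition pattern_fun p (F : pattern p) :
  {ffun nzvec p (pattern_dim F) -> bool} := tagged (val F).

(* A linear map 'F_p^m -> 'F_p^n is encoded by its matrix M acting on row
   vectors by v |-> v *m M, so a uniformly random linear map is a uniformly
   random m x n matrix. *)
Definition density (R : realType) (p n : nat) (F : pattern p)
    (A : {set 'rV['F_p]_n}) : R :=
  if (pattern_dim F <= n)%N then
    #|[set M : 'M['F_p]_(pattern_dim F, n) |
        [forall v : nzvec p (pattern_dim F),
          (val v *m M \in A) == pattern_fun F v]]%SET|%:R
    / #|{: 'M['F_p]_(pattern_dim F, n)}|%:R
  else 0.

Definition lineon (R : realType) (p : nat) : set {ptws pattern p -> R} :=
  [set psi | (forall F, (psi F : R) \in `[0, 1]) /\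
    exists (n : nat -> nat) (A : forall t, {set 'rV['F_p]_(n t)}),
      {homo n : s t / (s < t)%N} /\
      forall F : pattern p,
        (fun t => density R F (A t)) @ \oo --> (psi F : R)].

Arguments lineon R p : clear implicits.

(* Main.v *)
(** Given lineons [psi] and [phi], limits of [A_s] and [B_s], consider the sets
    of triples [(z, x, y)] such that [x \in A_s] if [z \in D_t], and
    [y \in B_s] otherwise, where [D_t] is the set of those [z] in ['F_p^s] whose
    base-[p] value is less than [t * p ^ s].  The three coordinates of a random
    linear map are independent, so the densities of these sets are
    multilinear in those of [D_t], [A_s] and [B_s].  Those of [D_t] converge
    as [s] grows, and since a random linear map sends a nonzero vector to a
    uniform one, the union bound makes the limit Lipschitz in [t].  At [t = 0]
    and [t = 1], [D_t] is empty, respectively full, so the resulting path of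
    lineons joins [phi] to [psi]. *)

Require Import Defs.
From mathcomp Require Import all_boot all_order all_algebra.
From mathcomp Require Import all_classical all_reals all_analysis.
From mathcomp Require Import zify ring lra.
Import numFieldNormedType.Exports.

Set Implicit Arguments.
Unset Strict Implicit.
Unset Printing Implicit Defensive.

Import Order.TTheory GRing.Theory Num.Theory.

Local Open Scope classical_set_scope.
Local Open Scope ring_scope.

(** * Pattern frequencies under a uniformly random matrix *)

Section Frequencies.
Variables (R : realType) (p : nat).
Implicit Types m n k : nat.

Definition profile m n (A : {set 'rV['F_p]_n}) (M : 'M['F_p]_(m, n)) :
  {ffun nzvec p m -> bool} := [ffun v => val v *m M \in A].

(** This is [density] without its guard on dimensions, so that exact identities hold for all [m] and
    [n]. *)
Definition freq m n (A : {set 'rV['F_p]_n}) (f : {ffun nzvec p m -> bool}) : R :=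
  #|[set M : 'M['F_p]_(m, n) | profile A M == f]%SET|%:R /
  #|{: 'M['F_p]_(m, n)}|%:R.

Lemma density_freq n (F : pattern p) (A : {set 'rV['F_p]_n}) :
  (pattern_dim F <= n)%N -> density R F A = freq A (pattern_fun F).
Proof.
rewrite /density /freq => ->; congr (_%:R / _).
apply: eq_card => M; rewrite !inE.
apply/forallP/eqP => [eqM|<- v]; last by rewrite ffunE.
by apply/ffunP => v; rewrite ffunE; exact/eqP.
Qed.

Lemma card_mx_neq0 m n : #|{: 'M['F_p]_(m, n)}|%:R != 0 :> R.
Proof. by rewrite pnatr_eq0 -lt0n; apply/card_gt0P; exists 0. Qed.

Lemma card_mx_gt0 m n : 0 < #|{: 'M['F_p]_(m, n)}|%:R :> R.
Proof. by rewrite lt0r card_mx_neq0 ler0n. Qed.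

Lemma freqE m n (A : {set 'rV['F_p]_n}) (f : {ffun nzvec p m -> bool}) :
  freq A f = (\sum_(M : 'M['F_p]_(m, n)) (profile A M == f)%:R) /
             #|{: 'M['F_p]_(m, n)}|%:R.
Proof.
by rewrite /freq -sum1dep_card natr_sum big_mkcond; congr (_ / _);
  apply: eq_bigr => M _; case: ifP.
Qed.

Lemma freq_ge0 m n (A : {set 'rV['F_p]_n}) (f : {ffun nzvec p m -> bool}) :
  0 <= freq A f.
Proof. by rewrite divr_ge0 ?ler0n. Qed.

Lemma freq_le1 m n (A : {set 'rV['F_p]_n}) (f : {ffun nzvec p m -> bool}) :
  freq A f <= 1.
Proof. by rewrite ler_pdivrMr ?card_mx_gt0// mul1r ler_nat max_card. Qed.

(** Group the matrices by profile: averages over random matrices become expectations over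
    patterns. *)
Lemma sum_profile m n (A : {set 'rV['F_p]_n}) (phi : {ffun nzvec p m -> bool} -> R) :
  \sum_(M : 'M['F_p]_(m, n)) phi (profile A M) =
  #|{: 'M['F_p]_(m, n)}|%:R * \sum_f phi f * freq A f.
Proof.
under [in RHS]eq_bigr => f _ do rewrite freqE mulrA mulr_sumr.
rewrite -mulr_suml mulrC divfK ?card_mx_neq0// exchange_big.
apply: eq_bigr => M _ /=; rewrite (bigD1 (profile A M))//= eqxx mulr1 big1 ?addr0//.
by move=> f /negPf; rewrite eq_sym => ->; rewrite mulr0.
Qed.

Lemma sum_freq m n (A : {set 'rV['F_p]_n}) :
  \sum_(f : {ffun nzvec p m -> bool}) freq A f = 1.
Proof.
apply: (mulfI (card_mx_neq0 m n)).
have := sum_profile A (fun _ : {ffun nzvec p m -> bool} => 1).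
rewrite sumr_const mulr1; under eq_bigr do rewrite mul1r.
by move<-.
Qed.

(** * Independence of column blocks and mixtures of sets *)

Lemma sum_row_mx m n1 n2 (phi : 'M['F_p]_(m, n1 + n2) -> R) :
  \sum_M phi M = \sum_M1 \sum_M2 phi (row_mx M1 M2).
Proof.
rewrite pair_big/= (reindex (fun x => row_mx x.1 x.2))//=.
exists (fun M => (lsubmx M, rsubmx M)) => [[M1 M2] _|M _] /=.
  by rewrite row_mxKl row_mxKr.
by rewrite hsubmxK.
Qed.

Lemma card_row_mx m n1 n2 :
  #|{: 'M['F_p]_(m, n1 + n2)}| = (#|{: 'M['F_p]_(m, n1)}| * #|{: 'M['F_p]_(m, n2)}|)%N.
Proof. by rewrite !card_mx mulnDr expnD. Qed.

Definition mix_set k n1 n2 (D : {set 'rV['F_p]_k}) (A : {set 'rV['F_p]_n1})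
    (B : {set 'rV['F_p]_n2}) : {set 'rV['F_p]_(k + (n1 + n2))} :=
  [set x | if lsubmx x \in D then lsubmx (rsubmx x) \in A
           else rsubmx (rsubmx x) \in B]%SET.

Definition mix_fun m (h g g' : {ffun nzvec p m -> bool}) :
  {ffun nzvec p m -> bool} := [ffun v => if h v then g v else g' v].

(** The three column blocks range independently over all matrices, and the profile of the mixture is
    [mix_fun] of the three block profiles; so [sum_profile] applies to one block at a time. *)
Lemma freq_mix m k n1 n2 (D : {set 'rV['F_p]_k}) (A : {set 'rV['F_p]_n1})
    (B : {set 'rV['F_p]_n2}) (f : {ffun nzvec p m -> bool}) :
  freq (mix_set D A B) f =
  \sum_h (\sum_g (\sum_g' (mix_fun h g g' == f)%:R * freq B g') * freq A g)
    * freq D h.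
Proof.
rewrite freqE; apply: (canLR (mulfK (card_mx_neq0 _ _))).
rewrite sum_row_mx !card_row_mx !natrM.
pose phi h g := \sum_g' (mix_fun h g g' == f)%:R * freq B g'.
pose psi h := \sum_g phi h g * freq A g.
transitivity (\sum_(M1 : 'M['F_p]_(m, k)) #|{: 'M['F_p]_(m, n1)}|%:R *
    (#|{: 'M['F_p]_(m, n2)}|%:R * psi (profile D M1))).
  apply: eq_bigr => M1 _; rewrite sum_row_mx /psi mulrCA -sum_profile mulr_sumr.
  apply: eq_bigr => M2 _; rewrite /phi -sum_profile.
  apply: eq_bigr => M3 _; congr ((_ == _)%:R).
  apply/ffunP => v; rewrite !ffunE !inE !mul_mx_row !(row_mxKl, row_mxKr).
  by [].
by rewrite -!mulr_sumr sum_profile; ring.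
Qed.

(** * Uniformity of the image of a nonzero vector, and the union bound *)

Lemma card_mulmx_fiber m n (v : 'rV['F_p]_m) (y : 'rV['F_p]_n) : v != 0 ->
  #|[set M : 'M['F_p]_(m, n) | v *m M == y]%SET| =
  #|[set M : 'M['F_p]_(m, n) | v *m M == 0]%SET|.
Proof.
(* [N] is a particular solution of [v *m N = y], so translation by [N] carries the fibre over 0 onto
   the fibre over [y]. *)
move=> v0; pose N := pinvmx v *m y.
have vN : v *m N = y by rewrite mulmxA mulmxVp ?mul1mx// /row_free rank_rV v0.
rewrite -[RHS](card_imset _ (addrI N)); apply: eq_card => M; rewrite !inE.
apply/eqP/imsetP => [vM|[M']].
  by exists (M - N); rewrite ?inE ?mulmxBr ?vM ?vN ?subrr// addrC subrK.
by rewrite inE => /eqP vM' ->; rewrite mulmxDr vN vM' addr0.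
Qed.

Lemma card_mulmx_preim m n (v : 'rV['F_p]_m) (S : {set 'rV['F_p]_n}) : v != 0 ->
  (#|[set M : 'M['F_p]_(m, n) | v *m M \in S]%SET| * #|{: 'rV['F_p]_n}| =
   #|S| * #|{: 'M['F_p]_(m, n)}|)%N.
Proof.
move=> v0; pose c := #|[set M : 'M['F_p]_(m, n) | v *m M == 0]%SET|.
have cardP (T : {set 'rV['F_p]_n}) :
    #|[set M : 'M['F_p]_(m, n) | v *m M \in T]%SET| = (#|T| * c)%N.
  rewrite -sum1dep_card (partition_big (mulmx v) (mem T))//= -sum_nat_const.
  apply: eq_bigr => y yT; rewrite /c -(card_mulmx_fiber y v0) -sum1dep_card.
  by apply: eq_bigl => M; case: eqP => [->|]; rewrite ?yT ?andbT ?andbF.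
rewrite cardP -mulnA; congr (_ * _)%N.
(* Taking [T] to be the whole space expresses the number of all matrices through the fibre size
   [c]. *)
have := cardP [set: 'rV_n]%SET; rewrite cardsT mulnC => <-.
by apply: eq_card => M; rewrite !inE.
Qed.

(* Union bound: a nonzero vector is mapped to a uniformly distributed vector. *)
Lemma freq_dist m n (A B : {set 'rV['F_p]_n}) (f : {ffun nzvec p m -> bool}) :
  A \subset B ->
  `|freq B f - freq A f| <=
  #|{: nzvec p m}|%:R * (#|B :\: A|%:R / #|{: 'rV['F_p]_n}|%:R).
Proof.
move=> AB; rewrite !freqE -mulrBl -sumrB normrM normfV normr_nat.
rewrite ler_pdivrMr ?card_mx_gt0//; apply: le_trans (ler_norm_sum _ _ _) _.
have -> : #|{: nzvec p m}|%:R * (#|B :\: A|%:R / #|{: 'rV['F_p]_n}|%:R) *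
    #|{: 'M['F_p]_(m, n)}|%:R =
    \sum_(v : nzvec p m)
      #|[set M : 'M['F_p]_(m, n) | val v *m M \in B :\: A]%SET|%:R :> R.
  rewrite -mulrA mulr_natl -sumr_const; apply: eq_bigr => v _.
  rewrite mulrAC; apply: (canLR (mulfK (card_mx_neq0 _ _))).
  by rewrite -!natrM card_mulmx_preim ?(valP v).
under [leRHS]eq_bigr => v _ do rewrite -sum1dep_card natr_sum big_mkcond.
rewrite exchange_big; apply: ler_sum => M _ /=.
have [->|] := eqVneq (profile A M) (profile B M).
  by rewrite subrr normr0; apply: sumr_ge0 => v _; case: ifP.
(* As [A] lies in [B], profiles that differ at [v] force [v *m M] into [B :\: A]; this one [v]
   contributes 1 on the right, which bounds the left side. *)
move=> neq; have /existsP[v vAB] : [exists v : nzvec p m, val v *m M \in B :\: A].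
  rewrite -[X in is_true X]negbK negb_exists; apply: contra neq => /forallP h.
  apply/eqP/ffunP => v; have := h v; rewrite !ffunE inE negb_and negbK.
  by have := fintype.subsetP AB (val v *m M); case: (_ \in A) (_ \in B) => [] [] // ->.
rewrite (bigD1 v)//= vAB; apply: (@le_trans _ _ 1); last first.
  by rewrite lerDl; apply: sumr_ge0 => w _; case: ifP.
by case: (_ == f); case: (_ == f);
  rewrite ?subrr ?normr0 ?subr0 ?sub0r ?normrN ?normr1.
Qed.

Lemma freq_cst_profile m n (A : {set 'rV['F_p]_n})
    (f g : {ffun nzvec p m -> bool}) :
  (forall M, profile A M = g) -> freq A f = (f == g)%:R.
Proof.
move=> Ag; rewrite freqE; under eq_bigr do rewrite Ag eq_sym.
by rewrite sumr_const -[_ *+ _]mulr_natl mulrAC divff ?mul1r ?card_mx_neq0.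
Qed.

Lemma freq_set0 m n (f : {ffun nzvec p m -> bool}) :
  freq (finset.set0 : {set 'rV['F_p]_n}) f = (f == [ffun=> false])%:R.
Proof.
by apply: freq_cst_profile => M; apply/ffunP => v; rewrite !ffunE inE.
Qed.

Lemma freq_setT m n (f : {ffun nzvec p m -> bool}) :
  freq [set: 'rV['F_p]_n]%SET f = (f == [ffun=> true])%:R.
Proof.
by apply: freq_cst_profile => M; apply/ffunP => v; rewrite !ffunE inE.
Qed.

End Frequencies.

(** * Initial segments in base [p] *)

Section InitialSegments.
Variables (R : realType) (p : nat) (p_prime : prime p).

(* The first coordinate is the least significant digit, because ['rV_k.+1] is
   convertible to ['rV_(1 + k)] but not to ['rV_(k + 1)]. *)
Fixpoint base_value k : 'rV['F_p]_k -> nat :=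
  match k with
  | 0 => fun=> 0%N
  | k'.+1 => fun y : 'rV_(1 + k') =>
      (lsubmx y 0%R 0%R + p * base_value (rsubmx y))%N
  end.

Lemma ltn_Fp (a : 'F_p) : (a < p)%N.
Proof. by rewrite -[X in (_ < X)%N](Fp_cast p_prime). Qed.

Lemma base_value_lt k (y : 'rV['F_p]_k) : (base_value y < p ^ k)%N.
Proof.
elim: k y => [y|k IHk y]; first by rewrite expn0.
have := IHk (rsubmx (y : 'rV_(1 + k))).
have := ltn_Fp (lsubmx (y : 'rV_(1 + k)) 0 0).
rewrite expnS /=; set a := nat_of_ord _; set b := base_value _; nia.
Qed.

Lemma base_value_inj k : injective (@base_value k).
Proof.
elim: k => [y z _|k IHk y z /= eqyz]; first by apply/rowP => - [].
have ltp := ltn_Fp; have p0 := prime_gt0 p_prime.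
have eql : lsubmx (y : 'rV_(1 + k)) 0 0 = lsubmx (z : 'rV_(1 + k)) 0 0.
  (* Reduction modulo [p] isolates the least significant digit. *)
  have := congr1 (modn^~ p) eqyz; rewrite ![(_ + p * _)%N]addnC ![(p * _)%N]mulnC.
  by rewrite !modnMDl !modn_small// => /val_inj.
have eqL : lsubmx (y : 'rV_(1 + k)) = lsubmx (z : 'rV_(1 + k)).
  by apply/matrixP => i j; rewrite !ord1.
have eqR : rsubmx (y : 'rV_(1 + k)) = rsubmx (z : 'rV_(1 + k)).
  apply: IHk; move: eqyz; rewrite eql => /addnI /eqP.
  by rewrite eqn_pmul2l// => /eqP.
by rewrite -[LHS](@hsubmxK _ 1 1 k) eqL eqR hsubmxK.
Qed.

Definition segment k j : {set 'rV['F_p]_k} :=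
  [set y | (base_value y < j)%N]%SET.

Lemma segment0 k : segment k 0 = finset.set0.
Proof. by apply/setP => y; rewrite !inE. Qed.

Lemma segment_full k j : (p ^ k <= j)%N -> segment k j = [set: 'rV_k]%SET.
Proof.
by move=> kj; apply/setP => y; rewrite !inE (leq_trans (base_value_lt y) kj).
Qed.

Lemma segment_subset k i j : (i <= j)%N -> segment k i \subset segment k j.
Proof.
move=> ij; apply/fintype.subsetP => y; rewrite !inE => yi; exact: leq_trans yi ij.
Qed.

(** [base_value] maps the difference injectively into the integers from [i] to [j - 1]. *)
Lemma card_segmentD k i j : (i <= j)%N ->
  (#|segment k j :\: segment k i| <= j - i)%N.
Proof.
move=> ij; rewrite cardE -(size_map (@base_value k)) -[leqRHS](size_iota i).
apply: uniq_leq_size.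
  by rewrite map_inj_uniq ?enum_uniq//; exact: base_value_inj.
move=> _ /mapP[y + ->]; rewrite mem_enum !inE mem_iota subnKC// -leqNgt.
by [].
Qed.

(** For a digit [a < p], [a + p * b < p * j] holds exactly when [b < j]. The larger segment is thus
    a cylinder over the smaller one, and the new digit averages out. *)
Lemma freq_segmentS m k j (f : {ffun nzvec p m -> bool}) :
  freq R (segment k.+1 (p * j)) f = freq R (segment k j) f.
Proof.
have seg (a : 'rV['F_p]_1) (y : 'rV_k) :
    (row_mx a y \in segment k.+1 (p * j)) = (y \in segment k j).
  rewrite !inE /= (row_mxKl a y) (row_mxKr a y).
  have := ltn_Fp (a 0 0); set b := base_value _; set c := nat_of_ord _ => cp.
  by apply/idP/idP; nia.
rewrite !freqE (@sum_row_mx R p m 1 k) (@card_row_mx p m 1 k) natrM.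
rewrite (eq_bigr (fun=> \sum_M (profile (segment k j) M == f)%:R)); last first.
  move=> M1 _; apply: eq_bigr => M2 _; congr ((_ == _)%:R).
  apply/ffunP => v; rewrite !ffunE -(seg (val v *m M1)).
  by rewrite -(@mul_mx_row _ _ _ 1 k).
rewrite sumr_const -[_ *+ _]mulr_natl invfM mulrACA divff ?mul1r//.
exact: card_mx_neq0.
Qed.

(** * Limit frequencies of segments as a function of their proportion [t] *)

Let p_gt0 : 0 < p%:R :> R. Proof. by rewrite ltr0n prime_gt0. Qed.

Lemma freq_segment_dist m k i j (f : {ffun nzvec p m -> bool}) : (i <= j)%N ->
  `|freq R (segment k j) f - freq R (segment k i) f| <=
  #|{: nzvec p m}|%:R * ((j%:R - i%:R) / p%:R ^+ k).
Proof.
move=> ij; apply: le_trans (freq_dist _ _ (segment_subset k ij)) _.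
rewrite ler_wpM2l// card_mx card_Fp// mul1n natrX ler_wpM2r//.
by rewrite -natrB// ler_nat card_segmentD.
Qed.

(** Every real [t] is allowed: [Num.truncn] vanishes on negative reals, so the segment is empty for
    [t < 0], and it is full from [t = 1] on. *)
Definition segment_freq m (t : R) (f : {ffun nzvec p m -> bool}) k : R :=
  freq R (segment k (Num.truncn (t * p%:R ^+ k))) f.

Lemma truncn_mul_le (x : R) (n : nat) : 0 <= x ->
  (n * Num.truncn x <= Num.truncn (n%:R * x) <= n * Num.truncn x + n)%N.
Proof.
move=> x0; have nx0 : 0 <= n%:R * x by rewrite mulr_ge0.
have /andP[xl xu] := truncn_itv x0; apply/andP; split.
  by rewrite truncn_ge_nat// natrM ler_wpM2l.
rewrite truncn_le_nat -mulnSr -natr1 natrM.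
rewrite (@le_lt_trans _ _ (n%:R * (Num.truncn x).+1%:R)) ?ltrDl//.
by rewrite ler_wpM2l// ltW.
Qed.

Lemma truncn_lt0 (x : R) : x < 0 -> Num.truncn x = 0%N.
Proof. by move=> x0; rewrite truncn_floor leNgt x0. Qed.

(** By [freq_segmentS] both segments can be compared in dimension [k.+1]. There, rounding before or
    after scaling by [p] changes the length by at most [p] among [p ^ k.+1] points. *)
Lemma segment_freqS m t (f : {ffun nzvec p m -> bool}) k :
  `|segment_freq t f k.+1 - segment_freq t f k| <=
  #|{: nzvec p m}|%:R * p%:R^-1 ^+ k.
Proof.
rewrite /segment_freq -(freq_segmentS k) exprS mulrCA.
set x := t * _; have [x0|x0] := leP 0 x; last first.
  have px0 : p%:R * x < 0 by rewrite pmulr_rlt0.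
  rewrite (truncn_lt0 x0) (truncn_lt0 px0) muln0 subrr normr0.
  by rewrite mulr_ge0// exprn_ge0// invr_ge0 ltW.
have /andP[le1 le2] := truncn_mul_le p x0.
apply: le_trans (freq_segment_dist _ _ le1) _.
rewrite ler_wpM2l// exprVn ler_pdivrMr ?exprn_gt0// exprS [leRHS]mulrCA mulVf ?mulr1.
  by rewrite lerBlDl -natrD ler_nat.
by rewrite expf_neq0// gt_eqF.
Qed.

(** Consecutive differences are dominated by a geometric series of ratio [1 / p], so the telescoping
    series converges absolutely. *)
Lemma is_cvg_segment_freq m t (f : {ffun nzvec p m -> bool}) :
  cvgn (segment_freq t f).
Proof.
have -> : segment_freq t f =
    (fun k => segment_freq t f 0 + series (telescope (segment_freq t f)) k).
  by apply/funext => k; rewrite -eq_sum_telescope.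
apply: is_cvgD; first exact: is_cvg_cst.
apply: normed_cvg.
apply: (@series_le_cvg _ _ (geometric #|{: nzvec p m}|%:R p%:R^-1)).
- by move=> k /=.
- by move=> k /=; rewrite mulr_ge0// exprn_ge0// invr_ge0 ltW.
- by move=> k /=; exact: segment_freqS.
- apply: is_cvg_geometric_series; rewrite normfV normr_nat invf_lt1//.
  by rewrite ltr1n prime_gt1.
Qed.

Definition lim_segment_freq m (t : R) (f : {ffun nzvec p m -> bool}) : R :=
  limn (segment_freq t f).

Lemma truncn_dist (x y : R) : x <= y ->
  (Num.truncn y)%:R - (Num.truncn x)%:R <= y - x + 1.
Proof.
move=> xy; have := truncnS_gt x; rewrite -natr1 => xu.
have [y0|y0] := leP 0 y; last by rewrite !truncn_lt0//; lra.
by have /andP[] := truncn_itv y0; lra.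
Qed.

(** The term [p%:R^-1 ^+ k] is the rounding error, one point among [p ^ k]; it vanishes in the
    limit. *)
Lemma segment_freq_dist m (s t : R) (f : {ffun nzvec p m -> bool}) k : s <= t ->
  `|segment_freq t f k - segment_freq s f k| <=
  #|{: nzvec p m}|%:R * (t - s + p%:R^-1 ^+ k).
Proof.
move=> st; have pk : 0 < p%:R ^+ k :> R by rewrite exprn_gt0.
have le : s * p%:R ^+ k <= t * p%:R ^+ k by rewrite ler_pM2r.
apply: le_trans (freq_segment_dist _ _ (le_truncn le)) _.
rewrite ler_wpM2l// ler_pdivrMr// mulrDl exprVn mulVf ?gt_eqF// mulrBl.
exact: truncn_dist.
Qed.

Lemma lim_segment_freq_dist m (s t : R) (f : {ffun nzvec p m -> bool}) : s <= t ->
  `|lim_segment_freq t f - lim_segment_freq s f| <= #|{: nzvec p m}|%:R * (t - s).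
Proof.
move=> st.
have cvgl : (fun k => `|segment_freq t f k - segment_freq s f k|) @ \oo -->
    `|lim_segment_freq t f - lim_segment_freq s f|.
  by apply: cvg_norm; apply: cvgB; exact: is_cvg_segment_freq.
have cvgr : (fun k => #|{: nzvec p m}|%:R * (t - s + p%:R^-1 ^+ k)) @ \oo -->
    #|{: nzvec p m}|%:R * (t - s).
  apply: cvgMr; rewrite -[X in _ --> X]addr0; apply: cvgD; first exact: cvg_cst.
  apply: cvg_expr; rewrite normfV normr_nat invf_lt1//.
  by rewrite ltr1n prime_gt1.
apply: (ler_cvg_to cvgl cvgr); near=> k; exact: segment_freq_dist.
Unshelve. all: by end_near. Qed.

Lemma continuous_lim_segment_freq m (f : {ffun nzvec p m -> bool}) :
  continuous (fun t => lim_segment_freq t f).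
Proof.
move=> t; apply/cvgrPdist_le => e e0.
(* The [+ 1] keeps [K] positive even when there are no nonzero vectors. *)
pose K : R := #|{: nzvec p m}|%:R + 1; have K0 : 0 < K by rewrite ltr_wpDl.
near=> s.
apply: (@le_trans _ _ (#|{: nzvec p m}|%:R * `|t - s|)).
  have [st|ts] := leP s t.
    by rewrite (ger0_norm (x := t - s)) ?subr_ge0// lim_segment_freq_dist.
  rewrite distrC [X in _ * X]distrC (gtr0_norm (x := s - t)) ?subr_gt0//.
  by rewrite lim_segment_freq_dist// ltW.
apply: (@le_trans _ _ (K * (e / K))); last by rewrite mulrC divfK// gt_eqF.
apply: ler_pM => //; first by rewrite lerDl.
by near: s; apply: cvgr_dist_le => //; rewrite divr_gt0.
Unshelve. all: by end_near. Qed.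

Lemma lim_segment_freq0 m (f : {ffun nzvec p m -> bool}) :
  lim_segment_freq 0 f = (f == [ffun=> false])%:R.
Proof.
rewrite /lim_segment_freq [segment_freq 0 f](_ : _ = fun=> (f == [ffun=> false])%:R).
  exact: lim_cst.
by apply/funext => k; rewrite /segment_freq mul0r truncn0 segment0 freq_set0.
Qed.

Lemma lim_segment_freq1 m (f : {ffun nzvec p m -> bool}) :
  lim_segment_freq 1 f = (f == [ffun=> true])%:R.
Proof.
rewrite /lim_segment_freq [segment_freq 1 f](_ : _ = fun=> (f == [ffun=> true])%:R).
  exact: lim_cst.
apply/funext => k.
by rewrite /segment_freq mul1r -natrX natrK segment_full// freq_setT.
Qed.

End InitialSegments.

(** * Tools for pointwise limits *)

Lemma continuous_ptws (X : topologicalType) (I : Type) (Y : topologicalType)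
    (f : X -> {ptws I -> Y}) :
  (forall i, continuous (fun x => f x i)) -> continuous f.
Proof.
(* The pointwise topology is the supremum of the initial topologies of the evaluations. *)
move=> cf x; apply/cvg_sup => i.
exact: (@continuous_comp_initial _ X Y (fun g : I -> Y => g i) f (cf i)).
Qed.

(** This ensures that the guard [pattern_dim F <= n s] in [density] holds from [s = pattern_dim F]
    on. *)
Lemma homo_ltn_ge_id (n : nat -> nat) :
  {homo n : s t / (s < t)%N} -> forall s, (s <= n s)%N.
Proof.
by move=> nS; elim=> // s IHs; exact: leq_ltn_trans IHs (nS _ _ (ltnSn s)).
Qed.

(** * The path between two lineons *)

Section MixingPath.
Variables (R : realType) (p : nat) (p_prime : prime p).

(** Reusing the positivity proof of [F] allows sums over all patterns of the same dimension. *)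
Definition with_fun (F : pattern p) (g : {ffun nzvec p (pattern_dim F) -> bool}) :
  pattern p := exist _ (existT _ (pattern_dim F) g) (svalP F).

Lemma with_pattern_fun (F : pattern p) : with_fun (pattern_fun F) = F.
Proof. by apply: val_inj; case: F => -[m f] Hm. Qed.

Lemma density_01 n (F : pattern p) (A : {set 'rV['F_p]_n}) :
  density R F A \in `[0, 1].
Proof.
have [le|gt] := leqP (pattern_dim F) n.
  by rewrite density_freq// in_itv/= freq_ge0 freq_le1.
by rewrite /density leqNgt gt in_itv/= lexx ler01.
Qed.

Lemma cvg_freq (n : nat -> nat) (A : forall s, {set 'rV['F_p]_(n s)})
    (psi : pattern p -> R) (F : pattern p) g :
  {homo n : s t / (s < t)%N} ->
  (forall F, (fun s => density R F (A s)) @ \oo --> psi F) ->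
  (fun s => freq R (A s) g) @ \oo --> psi (@with_fun F g).
Proof.
move=> nS cA; apply: cvg_trans (cA (with_fun g)); apply: near_eq_cvg.
exists (pattern_dim F) => // s /= Fs; rewrite density_freq//.
exact: leq_trans Fs (homo_ltn_ge_id nS s).
Qed.

(** At every stage the frequencies sum to 1, and a finite sum commutes with the limit. *)
Lemma sum_with_fun (n : nat -> nat) (A : forall s, {set 'rV['F_p]_(n s)})
    (psi : pattern p -> R) (F : pattern p) :
  {homo n : s t / (s < t)%N} ->
  (forall F, (fun s => density R F (A s)) @ \oo --> psi F) ->
  \sum_g psi (@with_fun F g) = 1.
Proof.
move=> nS cA.
have c1 : (fun s => \sum_(g : {ffun nzvec p (pattern_dim F) -> bool})
    freq R (A s) g) @ \oo --> \sum_g psi (@with_fun F g).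
  apply: cvg_big => [|g _]; [exact: add_continuous|exact: cvg_freq].
rewrite -(cvg_lim _ c1)//; under eq_fun do rewrite sum_freq.
exact: lim_cst.
Qed.

(** This is the formula of [freq_mix] with each frequency replaced by its limit. *)
Definition mix_path (psi phi : pattern p -> R) (t : R) :
    {ptws pattern p -> R} := fun F =>
  \sum_h (\sum_g (\sum_g' (mix_fun h g g' == pattern_fun F)%:R *
    phi (with_fun g')) * psi (with_fun g)) * lim_segment_freq t h.

Lemma continuous_mix_path psi phi : continuous (mix_path psi phi).
Proof.
apply: continuous_ptws => F t.
apply: cvg_big => [|h _]; first exact: add_continuous.
by apply: cvgMr; exact: continuous_lim_segment_freq.
Qed.

Section Endpoints.
Variables psi phi : pattern p -> R.
Hypothesis psi1 : forall F, \sum_g psi (@with_fun F g) = 1.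
Hypothesis phi1 : forall F, \sum_g phi (@with_fun F g) = 1.

(** At [t = 0] all mass sits on the constant pattern [h = false], for which [mix_fun h g g'] is
    [g']: the sum over [g'] selects [phi F], and [psi] sums to 1. *)
Lemma mix_path0 : mix_path psi phi 0 = phi.
Proof.
apply/funext => F; rewrite /mix_path (bigD1 [ffun=> false])//=.
rewrite [X in _ + X]big1 ?addr0 => [|h hF]; last first.
  by rewrite lim_segment_freq0 (negPf hF) mulr0.
rewrite lim_segment_freq0// eqxx mulr1 (eq_bigr (fun g => phi F * psi (with_fun g))).
  by rewrite -mulr_sumr psi1 mulr1.
move=> g _; congr (_ * _); rewrite (bigD1 (pattern_fun F))//= big1 => [|g' g'F].
  rewrite addr0 with_pattern_fun [mix_fun _ _ _](_ : _ = pattern_fun F).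
    by rewrite eqxx mul1r.
  by apply/ffunP => v; rewrite !ffunE.
rewrite [mix_fun _ _ _](_ : _ = g') ?(negPf g'F) ?mul0r//.
by apply/ffunP => v; rewrite !ffunE.
Qed.

(** Symmetrically, only [h = true] has mass and [mix_fun h g g'] is [g]; now [phi] sums to 1 and the
    sum over [g] selects [psi F]. *)
Lemma mix_path1 : mix_path psi phi 1 = psi.
Proof.
apply/funext => F; rewrite /mix_path (bigD1 [ffun=> true])//=.
rewrite [X in _ + X]big1 ?addr0 => [|h hF]; last first.
  by rewrite lim_segment_freq1// (negPf hF) mulr0.
rewrite lim_segment_freq1// eqxx mulr1.
rewrite (eq_bigr (fun g => (g == pattern_fun F)%:R * psi (with_fun g))).
  rewrite (bigD1 (pattern_fun F))//= big1 => [|g /negPf ->]; rewrite ?mul0r//.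
  by rewrite addr0 eqxx mul1r with_pattern_fun.
move=> g _; congr (_ * _); rewrite -[RHS]mulr1 -(phi1 F) mulr_sumr.
apply: eq_bigr => g' _; rewrite [mix_fun _ _ _](_ : _ = g)//.
by apply/ffunP => v; rewrite !ffunE.
Qed.

End Endpoints.

Lemma lineon_mix_path (psi phi : {ptws pattern p -> R}) (t : R) :
  lineon R p psi -> lineon R p phi -> lineon R p (mix_path psi phi t).
Proof.
move=> [_ [n [A [nS cA]]]] [_ [n' [B [n'S cB]]]].
pose N s := (s + (n s + n' s))%N.
pose C s : {set 'rV['F_p]_(N s)} :=
  mix_set (segment p s (Num.truncn (t * p%:R ^+ s))) (A s) (B s).
have NS : {homo N : s t / (s < t)%N}.
  by move=> i j ij; have := nS _ _ ij; have := n'S _ _ ij; rewrite /N; lia.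
have cC F : (fun s => density R F (C s)) @ \oo --> mix_path psi phi t F.
  have : (fun s => freq R (C s) (pattern_fun F)) @ \oo --> mix_path psi phi t F.
    under eq_fun do rewrite freq_mix.
    apply: cvg_big => [|h _]; first exact: add_continuous.
    apply: cvgM; last exact: is_cvg_segment_freq.
    apply: cvg_big => [|g _]; first exact: add_continuous.
    apply: cvgM; last exact: cvg_freq.
    apply: cvg_big => [|g' _]; first exact: add_continuous.
    by apply: cvgMr; exact: cvg_freq.
  (* Densities and frequencies agree once [N s] reaches [pattern_dim F]. *)
  apply: cvg_trans; apply: near_eq_cvg.
  exists (pattern_dim F) => // s /= Fs; rewrite density_freq//.
  exact: leq_trans Fs (homo_ltn_ge_id NS s).
split=> [F|]; last by exists N, C.
rewrite in_itv/=; apply/andP; split.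
  by apply: (cvgr_to_ge (cC F)); near=> s; have := density_01 F (C s);
    rewrite in_itv/= => /andP[].
by apply: (cvgr_to_le (cC F)); near=> s; have := density_01 F (C s);
  rewrite in_itv/= => /andP[].
Unshelve. all: by end_near. Qed.

End MixingPath.

Theorem theorem7p17 (R : realType) (p : nat) (p_prime : prime p) :
  path_connected R (lineon R p : set {ptws pattern p -> R}).
Proof.
(* [mix_path] runs from its second argument to its first, hence the order of the arguments. *)
move=> phi psi Lphi Lpsi; exists (mix_path psi phi).
have [_ [n [A [nS cA]]]] := Lphi.
have [_ [n' [B [n'S cB]]]] := Lpsi.
split.
- by apply: continuous_subspaceT; exact: continuous_mix_path.
- by apply: mix_path0 => F; exact: sum_with_fun n'S cB.
- by apply: mix_path1 => // F; exact: sum_with_fun nS cA.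
- by move=> t _; exact: lineon_mix_path.
Qed.
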